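(* Let $X$ be a Tychonoff locally Menger $p$-space, and let $Y=bX\setminus X$ be a remainder of $X$ in some compactification $bX$. If $Y$ is homogeneous, then $Y$ is an $s$-space.
   Context: A space $X$ is Menger if for each sequence $(\mathcal{U}_n)$ of open covers of $X$ there is a sequence $(\mathcal{V}_n)$ with each $\mathcal{V}_n$ a finite subset of $\mathcal{U}_n$ and $\bigcup_{n}\bigcup\mathcal{V}_n=X$. A space $X$ is locally Menger if for each $x\in X$ there exist an open set $U$ and a Menger subspace $Y$ of $X$ with $x\in U\subseteq Y$. A Tychonoff space $X$ is a $p$-space if in some (equivalently, any) compactification $bX$ there is a countable family $\{\mathcal{U}_n:n\in\mathbb{N}\}$, each $\mathcal{U}_n$ a collection of open subsets of $bX$, such that for each $x\in X$, $x\in\bigcap_{n}\bigcup\{U\in\mathcal{U}_n:x\in U\}\subseteq X$. For a family $\mathcal{C}$ of subsets of $Z$, $\mathcal{C}_\delta$ is the family of intersections of nonempty subfamilies of $\mathcal{C}$ and $\mathcal{C}_{\delta,\sigma}$ the family of unions of subfamilies of $\mathcal{C}_\delta$; $\mathcal{C}$ is a source for $Y\subseteq Z$ if $Y\in\mathcal{C}_{\delta,\sigma}$. A Tychonoff space $X$ is an $s$-space if there is a countable source for $X$ in some (equivalently, any) compactification $bX$ consisting of open subsets of $bX$. A space $Y$ is homogeneous if for any $x,y\in Y$ there is a homeomorphism $h:Y\to Y$ with $h(x)=y$. *)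

(* Defs.v *)
From HB Require Import structures.
From mathcomp Require Import all_boot all_order all_algebra.
From mathcomp Require Import all_classical all_reals all_analysis.
From mathcomp Require Import Rstruct Rstruct_topology.
From Stdlib Require Import Rdefinitions.

Set Implicit Arguments.
Unset Strict Implicit.
Unset Printing Implicit Defensive.

Local Open Scope classical_set_scope.

Definition tychonoff_space (X : topologicalType) : Prop :=
  accessible_space X /\
  forall (F : set X) (x : X), closed F -> ~ F x ->
    exists f : X -> Rdefinitions.R,
      continuous f /\ f x = 0%R /\ (forall y, F y -> f y = 1%R).

Definition menger_space (X : topologicalType) : Prop :=
  forall U : nat -> set (set X),
    (forall n, U n `<=` open) ->
    (forall n, \bigcup_(V in U n) V = [set: X]) ->
    exists W : nat -> set (set X),
      (forall n, finite_set (W n) /\ W n `<=` U n) /\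
      \bigcup_n \bigcup_(V in W n) V = [set: X].

(* Locally Menger: every point has an open neighbourhood contained in a
   Menger subspace (subspace = set_type with the induced topology). *)
Definition locally_menger_space (X : topologicalType) : Prop :=
  forall x : X, exists (U Z : set X),
    open U /\ U x /\ U `<=` Z /\ menger_space (set_type Z).

Definition is_compactification (X K : topologicalType) (e : X -> K) : Prop :=
  compact [set: K] /\ hausdorff_space K /\
  continuous e /\ injective e /\
  (forall U : set X, open U -> exists V : set K, open V /\ e @` U = range e `&` V) /\
  dense (range e).

Definition p_space (X : topologicalType) : Prop :=
  tychonoff_space X /\
  exists (K : topologicalType) (e : X -> K), is_compactification e /\
  exists U : nat -> set (set K),
    (forall n, U n `<=` open) /\
    forall x : X,
      (\bigcap_n \bigcup_(V in [set V | U n V /\ V (e x)]) V) (e x) /\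
      (\bigcap_n \bigcup_(V in [set V | U n V /\ V (e x)]) V) `<=` range e.

Definition is_source (Z : Type) (C : nat -> set Z) (Y : set Z) : Prop :=
  exists S : set (set nat),
    (forall s, S s -> s !=set0) /\
    Y = \bigcup_(s in S) \bigcap_(n in s) C n.

Definition s_space (X : topologicalType) : Prop :=
  tychonoff_space X /\
  exists (K : topologicalType) (e : X -> K), is_compactification e /\
  exists C : nat -> set K, (forall n, open (C n)) /\ is_source C (range e).

Definition homogeneous_space (Y : topologicalType) : Prop :=
  forall x y : Y, exists h g : Y -> Y,
    continuous h /\ continuous g /\ cancel h g /\ cancel g h /\ h x = y.

(* Main.v *)
(* Of the Menger property only its consequence "Lindelof" is used. A p-space is
   of countable type, so its remainder Y is Lindelof. Near a point of X adherent
   to Y, countably many open sets refining each family U_n cover X locally, and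
   the complements of their closures separate the nearby points of Y from X.
   This countable separation is expressed by filters on Y only, hence is
   transported by homeomorphisms of Y; homogeneity spreads it to a neighbourhood
   of every point and Lindelofness to all of Y. *)
Require Import Defs.
From HB Require Import structures.
From mathcomp Require Import all_boot all_order all_algebra.
From mathcomp Require Import finmap all_classical all_reals all_analysis.
From mathcomp Require Import Rstruct Rstruct_topology.
Set Implicit Arguments.
Unset Strict Implicit.
Unset Printing Implicit Defensive.

Local Open Scope classical_set_scope.

(** * Covers in compact, regular and Menger spaces *)

Lemma compact_finite_subfamily (T : topologicalType) (A : set T)
    (O : set (set T)) :
  compact A -> O `<=` open -> A `<=` \bigcup_(V in O) V ->
  exists W, [/\ finite_set W, W `<=` O & A `<=` \bigcup_(V in W) V].
Proof.
move=> cA oO AO.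
have [->|/set0P[x _]] := eqVneq A set0.
  by exists set0; split=> //; exact: finite_set0.
pose T' : ptopologicalType := HB.pack T (isPointed.Build T x).
have : @cover_compact T' A by rewrite -compact_cover.
move=> /(_ _ O id)[//|//|W WO AW].
exists [set` W]; split=> //; last by move=> V /WO; rewrite inE.
Qed.

Lemma compact_regular_open (T : topologicalType) (x : T) (U : set T) :
  hausdorff_space T -> compact [set: T] -> open U -> U x ->
  exists V, [/\ open V, V x & closure V `<=` U].
Proof.
move=> hT cT oU Ux.
have regx := @compact_regular T x setT hT cT filterT.
have [|V nV VU] := regx _ U.
  exact: open_nbhs_nbhs.
exists V°; split; [exact: open_interior|by []|].
by apply: subset_trans VU; apply: closureS; exact: interior_subset.
Qed.

Lemma menger_lindelof (T : topologicalType) (O : set (set T)) :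
  menger_space T -> O `<=` open -> \bigcup_(V in O) V = setT ->
  exists W, [/\ countable W, W `<=` O & \bigcup_(V in W) V = setT].
Proof.
move=> mT oO OT; have [//|//|W [finW WT]] := mT (fun=> O).
exists (\bigcup_n W n); split.
- apply: bigcup_countable => // n _; apply: finite_set_countable.
  by case: (finW n).
- by move=> V [n _ WV]; have [_] := finW n; exact.
- by rewrite bigcup_bigcup.
Qed.

(** * Filters and cluster points along an embedding *)

Section embedding.
Variables (X K : topologicalType) (e : X -> K).

Lemma compactification_open_preimage (U : set X) :
  is_compactification e -> open U -> exists2 V, open V & U = e @^-1` V.
Proof.
case=> _ [_ [_ [einj [eop _]]]] /eop [V [oV eUV]]; exists V => //.
apply/seteqP; split => x /=.
  by move=> Ux; have : (e @` U) (e x) by []; rewrite eUV => -[].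
move=> Vx; have : (range e `&` V) (e x) by [].
by rewrite -eUV => -[u Uu /einj <-].
Qed.

(** The hypothesis on open sets says that [e] induces the topology of [X]; in this form it covers
    compactifications, subspace inclusions and homeomorphisms alike. *)
Lemma cluster_fmap (F : set_system X) (x : X) :
  Filter F ->
  (forall U, open U -> exists2 V, open V & U = e @^-1` V) ->
  cluster (e @ F) (e x) -> cluster F x.
Proof.
move=> FF eop clF A B FA; rewrite nbhsE => -[U [/eop [V oV ->] Vx] UB].
have [|_ [[a Aa <-] Va]] := clF (e @` A) V _ (open_nbhs_nbhs (conj oV Vx)).
  by apply: (@filterS _ F _ A) => // a Aa; exists a.
by exists a; split => //; exact: UB.
Qed.

(** A point of [K] becomes a filter on [X] alone, which can be pushed into another compactification
    or tested for cluster points in [X]. *)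
Definition trace_filter (z : K) : set_system X :=
  filter_from (nbhs z) (fun N => e @^-1` N).

Lemma trace_filter_proper (z : K) :
  dense (range e) -> ProperFilter (trace_filter z).
Proof.
move=> de; apply: filter_from_proper.
  apply: filter_from_filter; first by exists setT; exact: filterT.
  by move=> N M nN nM; exists (N `&` M) => //; exact: filterI.
move=> N; rewrite nbhsE => -[U [oU Uz] UN].
have [|//|y [Uy [x _ exy]]] := de U; first by exists z.
by exists x; apply: UN; rewrite exy.
Qed.

Lemma cluster_trace_filter (z : K) (x : X) :
  hausdorff_space K -> continuous e -> cluster (trace_filter z) x -> z = e x.
Proof.
move=> hK ce cl; apply: hK => N M nN nM.
have [||a [Na Ma]] := cl (e @^-1` N) (e @^-1` M); first by exists N.
  exact: ce.
by exists (e a).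
Qed.

End embedding.

Lemma cluster_closure (T : topologicalType) (F : set_system T) (A : set T)
    (x : T) : cluster F x -> F A -> closure A x.
Proof. by rewrite clusterE => /[apply]. Qed.

(** * Featherings and Lindelof remainders *)

Definition feathering (X : Type) (K : topologicalType) (e : X -> K)
    (U : nat -> set (set K)) : Prop :=
  [/\ forall n, U n `<=` open,
      forall x n, exists2 V, U n V & V (e x) &
      forall x z, (forall n, exists2 V, U n V & V (e x) /\ V z) -> range e z].

(* Feathering is intrinsic: call G small of order n if its closure in the given
   compactification lies in a member of the n-th family. A filter
   containing, for every n, a small set of order n around a fixed point x
   clusters in X, and this no longer mentions the compactification. *)
Lemma p_space_feathering (X K : topologicalType) (e : X -> K) :
  p_space X -> is_compactification e -> exists U, feathering e U.
Proof.
move=> [_ [K' [e' [ce' [U' [oU' pU']]]]]] ce.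
have [cK' [hK' [conte' _]]] := ce'.
have [cK [hK [conte [_ [_ de]]]]] := ce.
pose small n := [set G : set X |
  exists2 V, U' n V & closure (e' @` G) `<=` V].
exists (fun n => [set V | open V /\ small n (e @^-1` V)]); split.
- by move=> n V [].
- move=> x n; have [/(_ n I)[V [U'V _] Vx] _] := pU' x.
  have [W [oW Wx WV]] := compact_regular_open hK' cK' (oU' n V U'V) Vx.
  have /(compactification_open_preimage ce)[N oN eN] : open (e' @^-1` W).
    by have /continuousP := conte'; exact.
  exists N; last by have : (e @^-1` N) x by rewrite -eN.
  split=> //; exists V => //; rewrite -eN; apply: subset_trans WV.
  by apply: closureS; exact: image_preimage_subset.
- move=> x z Vz.
  have FF := trace_filter_proper z de.
  (* The neighbourhoods of [z] are read in [K']. By smallness their cluster point [z'] lies in every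
     star of [e' x], hence comes from some [x'], and this forces [z = e x']. *)
  have [z' [_ clz']] := cK' (e' @ trace_filter e z) _ filterT.
  have [x' _ ex'] : range e' z'.
    have [_] := pU' x; apply => n _.
    have [V [oV [V' U'V' eVV']] [Vx Vz']] := Vz n.
    exists V'; last first.
      apply: eVV'; apply: cluster_closure clz' _.
      by exists V; [exact: open_nbhs_nbhs|move=> y Vy; exists y].
    split=> //; apply: eVV'; apply: subset_closure; exists x => //.
  exists x' => //; apply/esym; apply: (cluster_trace_filter hK conte).
  apply: (@cluster_fmap _ _ e'); last by rewrite ex'.
  by move=> G oG; exact: compactification_open_preimage.
Qed.

(** The part [C] of [K] missed by [O] is compact inside [X]. The feathering encloses it in a G-delta
    subset of [X], the intersection of open sets [D n]; each complement of [D n] is compact and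
    needs only finitely many members of [O]. *)
Lemma feathering_lindelof (X K : topologicalType) (e : X -> K)
    (U : nat -> set (set K)) (O : set (set K)) :
  hausdorff_space K -> compact [set: K] -> feathering e U ->
  O `<=` open -> ~` range e `<=` \bigcup_(V in O) V ->
  exists W, [/\ countable W, W `<=` O & ~` range e `<=` \bigcup_(V in W) V].
Proof.
move=> hK cK [oU Ux Uz] oO OY.
pose C := ~` \bigcup_(V in O) V.
have clC : closed C by apply: open_closedC; exact: bigcup_open.
have cC : compact C by apply: subclosed_compact cK _.
have CX : C `<=` range e by move=> z Cz; apply: contrapT => /OY.
(* Closures must fit into members of [U n], since a limit of points of a member of [S n] is only
   known to lie in its closure. *)
have /choice[S finS] n : exists S, [/\ finite_set S,
    S `<=` [set V | open V /\ exists2 N, U n N & closure V `<=` N] &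
    C `<=` \bigcup_(V in S) V].
  apply: compact_finite_subfamily => //; first by move=> V [].
  move=> _ /CX[x _ <-].
  have [N UN Nx] := Ux x n.
  have [V [oV Vx VN]] := compact_regular_open hK cK (oU n N UN) Nx.
  by exists V => //; split=> //; exists N.
pose St k x := \bigcup_(V in [set V | S k V /\ V x]) V.
(* If z lies in every D n, some x_n in C shares with z a member of S k for each
   k <= n. As S k is finite, a cluster point of (x_n) lies in the closure of a
   member of S k containing z, for every k at once. *)
pose D n := \bigcup_(x in C) \bigcap_(k in `I_n.+1) St k x.
have oD n : open (D n).
  apply: bigcup_open => x _.
  rewrite -closedC setC_bigcap; apply: closed_bigcup; first exact: finite_II.
  move=> k _; rewrite closedC.
  by apply: bigcup_open => V [SV _]; have [_ /(_ _ SV)[]] := finS k.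
have CD n : C `<=` D n.
  move=> x Cx; exists x => // k _; have [_ _ /(_ _ Cx)[V SV Vx]] := finS k.
  by exists V.
have DX z : (forall n, D n z) -> range e z.
  move=> Dz.
  have /choice[x xP] n : exists x, C x /\ (\bigcap_(k in `I_n.+1) St k x) z.
    by have [x] := Dz n; exists x.
  have [a [Ca cla]] : C `&` cluster (x @ \oo) !=set0.
    by apply: cC; exists 0%N => // n _; exact: (xP n).1.
  have [x0 _ ex0] := CX _ Ca; apply: (Uz x0) => k; rewrite ex0.
  have [finSk Sk _] := finS k.
  have : (\bigcup_(V in S k `&` [set V | V z]) closure V) a.
    apply: (closed_bigcup (finite_setIl _ finSk)) => [V _|].
      exact: closed_closure.
    apply: cluster_closure cla _; exists k => // n /= kn.
    have [V [SV Vx] Vz] := (xP n).2 k kn.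
    by exists V => //; exact: subset_closure.
  move=> [V [SV Vz] clVa]; have [_ [N UN VN]] := Sk _ SV.
  by exists N => //; split; apply: VN => //; exact: subset_closure.
have /choice[W WP] n : exists W, [/\ finite_set W, W `<=` O &
    ~` D n `<=` \bigcup_(V in W) V].
  apply: compact_finite_subfamily => //.
    by apply: subclosed_compact cK _ => //; exact: open_closedC.
  by move=> z /(contra_not (CD n z)) /contrapT.
exists (\bigcup_n W n); split.
- apply: bigcup_countable => // n _; apply: finite_set_countable.
  by case: (WP n).
- by move=> V [n _ WV]; case: (WP n) => _ + _; exact.
- move=> z nz; apply: contrapT => nW; apply: nz; apply: DX => n.
  apply: contrapT => nDz; apply: nW.
  have [_ _ /(_ _ nDz)[V WV Vz]] := WP n.
  by exists V => //; exists n.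
Qed.

(** * Countable families and countable separation *)

Lemma countable_image (T U : Type) (f : T -> U) (A : set T) :
  countable A -> countable (f @` A).
Proof. exact/sub_countable/card_image_le. Qed.

Lemma countableU1 (T : Type) (x : T) (A : set T) :
  countable A -> countable (x |` A).
Proof.
by move=> cA; rewrite -bigcup2E; apply: bigcup_countable => // -[|[|n]] _ /=.
Qed.

Lemma countable_range (T : Type) (A : set T) :
  countable A -> A !=set0 -> exists f : nat -> T, range f = A.
Proof.
move=> /pfcard_geP[->|[f]]; first by case.
by exists f; exact: image_eq.
Qed.

(* A countable family of open sets that tells the points of V apart from the
   points at infinity of Y, the latter being represented by the filters of Y
   without cluster point so as not to depend on a compactification. *)
Definition countably_separated (Y : topologicalType) (V : set Y) : Prop :=
  exists D : set (set Y), [/\ countable D, D `<=` open &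
    forall F, ProperFilter F -> cluster F = set0 ->
      forall y, V y -> exists2 C, D C & C y /\ ~ F C].

Lemma countably_separated_bigcup (Y : topologicalType) (W : set (set Y)) :
  countable W -> (forall V, W V -> countably_separated V) ->
  countably_separated (\bigcup_(V in W) V).
Proof.
move=> cW sW.
have /choice[D DP] (V : set Y) : exists D : set (set Y), W V ->
    [/\ countable D, D `<=` open &
    forall F, ProperFilter F -> cluster F = set0 ->
      forall y, V y -> exists2 C, D C & C y /\ ~ F C].
  by have [/sW[D ?]|nW] := pselect (W V); [exists D|exists set0].
exists (\bigcup_(V in W) D V); split.
- by apply: bigcup_countable => // V /DP[].
- by move=> C [V /DP[_ + _]]; apply.
- move=> F FF F0 y [V WV Vy]; have [_ _ sV] := DP V WV.
  by have [C DC Cy] := sV F FF F0 y Vy; exists C => //; exists V.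
Qed.

Lemma countably_separated_preimage (Y Z : topologicalType) (h : Y -> Z)
    (g : Z -> Y) (V : set Z) :
  continuous h -> continuous g -> cancel h g -> cancel g h ->
  countably_separated V -> countably_separated (h @^-1` V).
Proof.
move=> ch cg hK gK [D [cD oD sD]].
exists [set h @^-1` C | C in D]; split.
- exact: countable_image.
- by move=> _ [C DC <-]; have /continuousP := ch; apply; exact: oD.
- move=> F FF F0 y Vy.
  have [|C DC [Cy FC]] := sD (h @ F) _ _ (h y) Vy; last first.
    by exists (h @^-1` C) => //; exists C.
  (* A cluster point [z] of [h @ F] would give the cluster point [g z] of [F]. *)
  apply/seteqP; split=> // z clz.
  suff : cluster F (g z) by rewrite F0.
  apply: (@cluster_fmap _ _ h); last by rewrite gK.
  move=> U oU; exists (g @^-1` U); first by have /continuousP := cg; exact.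
  by apply/seteqP; split=> a /=; rewrite hK.
Qed.

(** A point [z] of [L] outside [Y] traces a filter on [Y] without cluster point, so some [A] in [D]
    contains [y] but is not in that filter; the extension of [A] to [L] then contains [j y] and not
    [z]. Hence the members of the source containing [j y] intersect inside [Y]. *)
Lemma countably_separated_source (Y L : topologicalType) (j : Y -> L) :
  is_compactification j -> countably_separated [set: Y] ->
  exists C : nat -> set L, (forall n, open (C n)) /\ is_source C (range j).
Proof.
move=> cj [D [cD oD sD]].
have [cL [hL [contj [_ [_ dj]]]]] := cj.
(* The largest open subset of [L] whose trace on [Y] lies in [C]. *)
pose ext (C : set Y) := ~` closure (j @` (~` C)).
(* Adding [setT] makes the family nonempty, hence enumerable, and gives every point of [Y] at least
   one index. *)
have [|//|C CE] := @countable_range _ (setT |` ext @` D).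
- by apply: countableU1; exact: countable_image.
- by exists setT; left.
have oC n : open (C n).
  have : range C (C n) by exists n.
  rewrite CE => -[->|[A _ <-]]; first exact: openT.
  exact/closed_openC/closed_closure.
exists C; split=> //.
exists [set s | s !=set0 /\ \bigcap_(n in s) C n `<=` range j].
split; first by move=> s [].
apply/seteqP; split; last by move=> z [s [_ sj]]; exact: sj.
move=> _ [y _ <-]; exists [set n | C n (j y)] => //; split.
  have : (setT |` ext @` D) setT by left.
  by rewrite -CE => -[n _ Cn]; exists n; rewrite /= Cn.
move=> z zC; apply: contrapT => nz.
have FF := trace_filter_proper z dj.
have [|A DA [Ay nFA]] := sD _ FF _ y I.
  apply/seteqP; split=> // y' /(cluster_trace_filter hL contj) zy.
  by apply: nz; exists y'.
have : (setT |` ext @` D) (ext A) by right; exists A.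
rewrite -CE => -[n _ CnA]; have : C n z.
  apply: zC; rewrite /= CnA => clA.
  have [V oV AV] := compactification_open_preimage cj (oD _ DA).
  have [|a [[b nAb <-] Vb]] := clA V.
    by apply: open_nbhs_nbhs; split=> //; move: Ay; rewrite AV.
  by apply: nAb; rewrite AV.
rewrite CnA; apply => N Nz; apply: contrapT => nmeet; apply: nFA.
exists N => // y' Ny'; apply: contrapT => nAy'; apply: nmeet.
by exists (j y'); split => //; exists y'.
Qed.

Lemma countable_sub_image (T U : Type) (f : T -> U) (A : set T) (B : set U) :
  countable B -> B `<=` f @` A ->
  exists C, [/\ countable C, C `<=` A & f @` C = B].
Proof.
move=> cB BA.
have [[b Bb]|B0] := pselect (B !=set0); last first.
  exists set0; split=> //; rewrite image_set0.
  apply/esym/seteqP; split=> // b Bb.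
  by apply: B0; exists b.
have [a0 _ _] := BA b Bb.
have /choice[g gP] u : exists a, B u -> A a /\ f a = u.
  by have [/BA[a Aa fa]|] := pselect (B u); [exists a|exists a0].
exists (g @` B); split; first exact: countable_image.
  by move=> _ [u Bu <-]; case: (gP u Bu).
apply/seteqP; split=> [_ [_ [u Bu <-] <-]|u Bu].
  by rewrite (gP u Bu).2.
by exists (g u); [exists u|rewrite (gP u Bu).2].
Qed.

(** Compactness gives a cluster point in [K]; it cannot come from [Y], where [F] would then cluster
    too. *)
Lemma cluster_fmap_remainder (X K Y : topologicalType) (e : X -> K) (j : Y -> K)
    (F : set_system Y) :
  compact [set: K] ->
  (forall V, open V -> exists2 W, open W & V = j @^-1` W) ->
  range j = ~` range e -> ProperFilter F -> cluster F = set0 ->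
  exists x, cluster (j @ F) (e x).
Proof.
move=> cK jopen jr FF F0.
have [z [_ clz]] := cK (j @ F) _ filterT.
have [[x _ ex]|nz] := pselect (range e z); first by exists x; rewrite ex.
have : (~` range e) z by [].
rewrite -jr => -[y _ jy]; suff : cluster F y by rewrite F0.
by apply: (cluster_fmap _ jopen); rewrite jy.
Qed.

Lemma locally_menger_countably_separated (X K Y : topologicalType)
    (e : X -> K) (j : Y -> K) (U : nat -> set (set K)) (x0 : X) :
  is_compactification e -> feathering e U ->
  continuous j -> (forall V, open V -> exists2 W, open W & V = j @^-1` W) ->
  range j = ~` range e -> locally_menger_space X ->
  exists W, [/\ open W, W (e x0) & countably_separated (j @^-1` W)].
Proof.
move=> ce [oU Ux Uz] cj jopen jr /(_ x0)[B [Z [oB [Bx0 [BZ mZ]]]]].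
have [cK [hK [conte _]]] := ce.
have [B' oB' BB'] := compactification_open_preimage ce oB.
have [|W [oW Wx0 WB']] := @compact_regular_open _ (e x0) B' hK cK oB'.
  by move: Bx0; rewrite BB'.
have /choice[S SP] n : exists S, [/\ countable S,
    S `<=` [set V | open V /\ exists2 N, U n N & closure V `<=` N] &
    forall x, Z x -> exists2 V, S V & V (e x)].
  pose R V : set (set_type Z) := [set z | V (e (set_val z))].
  pose O := [set V | open V /\ exists2 N, U n N & closure V `<=` N].
  have [||Q [cQ QO QT]] := @menger_lindelof _ (R @` O) mZ.
  - move=> _ [V [oV _] <-].
    have /continuousP/(_ V oV) := conte.
    by have /continuousP := @initial_continuous (set_type Z) X set_val; apply.
  - apply/seteqP; split=> // z _.
    have [N UN Nz] := Ux (set_val z) n.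
    have [V [oV Vz VN]] := compact_regular_open hK cK (oU n N UN) Nz.
    by exists (R V) => //; exists V => //; split=> //; exists N.
  have [S [cS SO SQ]] := countable_sub_image cQ QO.
  exists S; split=> // x Zx.
  have : [set: set_type Z] (SigSub (mem_set Zx)) by [].
  by rewrite -QT -SQ => -[_ [V SV <-]] Vx; exists V.
exists W; split=> //.
(* The trace of [W] deals with filters clustering outside [closure W], the complements of closures
   with those clustering at a point of [Z]. *)
exists (j @^-1` W |` [set j @^-1` (~` closure V) | V in \bigcup_n S n]); split.
- apply/countableU1/countable_image/bigcup_countable => // n _.
  by case: (SP n).
- have /continuousP oj := cj.
  by move=> _ [->|[V _ <-]]; apply: oj => //; exact/closed_openC/closed_closure.
move=> F FF F0 y Wy.
have [x clx] := cluster_fmap_remainder cK jopen jr FF F0.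
have [clWx|nWx] := pselect (closure W (e x)); last first.
  exists (j @^-1` W); first by left.
  by split=> // FW; apply: nWx; exact: cluster_closure clx _.
have Zx : Z x by apply: BZ; rewrite BB'; exact: WB'.
(* Otherwise the feathering would put [j y] into the range of [e]. *)
have [n nV] : exists n, forall V, U n V -> V (e x) -> ~ V (j y).
  apply: contrapT => nn; have : range j (j y) by exists y.
  rewrite jr; apply; apply: (Uz x) => n; apply: contrapT => nV; apply: nn.
  by exists n => V UV Vx Vy; apply: nV; exists V.
have [_ SO /(_ x Zx)[V SV Vx]] := SP n.
have [oV [N UN VN]] := SO V SV.
exists (j @^-1` (~` closure V)); first by right; exists V => //; exists n.
split=> [clVy|FV].
  by apply: (nV N UN); apply: VN => //; exact: subset_closure.
have nVx : closure (~` closure V) (e x) by exact: cluster_closure clx _.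
have [|k [nVk Vk]] := nVx V; first exact: open_nbhs_nbhs.
by apply: nVk; exact: subset_closure.
Qed.

(** * Subspaces of a compact Hausdorff space *)

Lemma set_val_open (T : topologicalType) (A : set T) (V : set (set_type A)) :
  open V -> exists2 W, open W & V = set_val @^-1` W.
Proof. by case=> W oW <-; exists W. Qed.

Lemma range_set_val (T : Type) (A : set T) : range (@set_val T A) = A.
Proof.
apply/seteqP; split=> [_ [a _ <-]|a Aa]; first exact: set_valP.
by exists (SigSub (mem_set Aa)).
Qed.

Lemma set_val_injective (T : Type) (A : set T) : injective (@set_val T A).
Proof. by rewrite set_valE; exact: val_inj. Qed.

Lemma hausdorff_set_type (T : topologicalType) (A : set T) :
  hausdorff_space T -> hausdorff_space (set_type A).
Proof.
move=> hT p q pq; apply/set_val_injective/hT => M N nM nN.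
have [||a [Ma Na]] := pq (set_val @^-1` M) (set_val @^-1` N).
- exact: initial_continuous.
- exact: initial_continuous.
- by exists (set_val a).
Qed.

Lemma compact_set_type (T : topologicalType) (A : set T) :
  compact A -> compact [set: set_type A].
Proof.
move=> cA F FF _.
have [|z [Az clz]] := cA (set_val @ F) _.
  by apply: (@filterE _ F _ (set_val @^-1` A)) => a; exact: set_valP.
exists (SigSub (mem_set Az)); split=> //.
by apply: (cluster_fmap _ (@set_val_open _ _)); exact: clz.
Qed.

Lemma tychonoff_set_type (T : topologicalType) (A : set T) :
  hausdorff_space T -> compact [set: T] -> tychonoff_space (set_type A).
Proof.
move=> hT cT; split; first exact/hausdorff_accessible/hausdorff_set_type.
move=> F x clF nFx.
have [W oW FW] := set_val_open (closed_openC clF).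
have clx : closed [set set_val x].
  by have /hausdorff_accessible/accessible_closed_set1 := hT; exact.
have [|f [cf fx fF _]] := @urysohn_ext_itv T Rdefinitions.R
    (compact_normal hT cT) [set set_val x] (~` W) 0%R 1%R clx
    (open_closedC oW) _ (Num.Theory.ltr01).
  apply/seteqP; split=> // _ [-> nWx]; apply: nWx.
  by have : (~` F) x by []; rewrite FW.
exists (f \o set_val); split; first last.
  split; first by apply: fx; exists (set_val x).
  move=> y Fy; apply: fF; exists (set_val y) => //= Wy.
  by have : (~` F) y by rewrite FW.
by move=> y; apply: continuous_comp; [exact: initial_continuous|exact: cf].
Qed.

(** A remainder need not be dense in [K]; its closure is the compactification in which the source is
    built. *)
Lemma closure_compactification (T : topologicalType) (A : set T) :
  hausdorff_space T -> compact [set: T] ->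
  exists e : set_type A -> set_type (closure A), is_compactification e.
Proof.
move=> hT cT.
pose e (a : set_type A) : set_type (closure A) :=
  SigSub (mem_set (subset_closure (set_valP a))).
have vale a : set_val (e a) = set_val a by [].
exists e; do !split.
- apply: compact_set_type; apply: subclosed_compact cT _ => //.
  exact: closed_closure.
- exact: hausdorff_set_type.
- apply/continuousP => V /set_val_open[W oW ->].
  by have /continuousP := @initial_continuous (set_type A) T set_val; exact.
- by move=> a b eab; apply: set_val_injective; rewrite -!vale eab.
- move=> V /set_val_open[W oW ->]; exists (set_val @^-1` W); split.
    have /continuousP := @initial_continuous (set_type (closure A)) T set_val.
    exact.
  apply/seteqP; split=> [_ [a Wa <-]|_ [[a _ <-] Wa]]; last by exists a.
  by split; first exists a.
- move=> V [z Vz] /set_val_open[W oW VW].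
  have [|a [Aa Wa]] := set_valP z W.
    by apply: open_nbhs_nbhs; split=> //; move: Vz; rewrite VW.
  exists (e (SigSub (mem_set Aa))); split; last by exists (SigSub (mem_set Aa)).
  by rewrite VW.
Qed.

Theorem theorem5p3 (X K : topologicalType) (e : X -> K) :
  tychonoff_space X -> locally_menger_space X -> p_space X ->
  is_compactification e ->
  homogeneous_space (set_type (~` range e)) ->
  s_space (set_type (~` range e)).
Proof.
move=> _ mX pX ce hY.
have [cK [hK _]] := ce.
have [U fU] := p_space_feathering pX ce.
pose j : set_type (~` range e) -> K := set_val.
have cj : continuous j by exact: initial_continuous.
have jopen := @set_val_open K (~` range e).
have jr : range j = ~` range e := range_set_val _.
have sepY : countably_separated [set: set_type (~` range e)].
  pose O := [set W | open W /\ countably_separated (j @^-1` W)].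
  have OY : ~` range e `<=` \bigcup_(W in O) W.
    rewrite -jr => _ [y _ <-].
    have [[x0 clx0]|nclx] := pselect (exists x, closure (range j) (e x)).
      have [W [oW Wx0 sW]] :=
        locally_menger_countably_separated x0 ce fU cj jopen jr mX.
      (* Since [e x0] is adherent to [Y], [W] contains a point [y0] of [Y]; a homeomorphism taking
         [y] to [y0] pulls the separation back to [y]. *)
      have [|_ [[y0 _ <-] Wy0]] := clx0 W; first exact: open_nbhs_nbhs.
      have [h [g [ch [cg [hK' [gK hy]]]]]] := hY y y0.
      have [|W' oW' hW'] := jopen (h @^-1` (j @^-1` W)).
        by have /continuousP := ch; apply; have /continuousP := cj; exact.
      exists W'; last first.
        by have : (j @^-1` W') y by rewrite -hW' /= hy.
      split=> //; rewrite -hW'.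
      exact: countably_separated_preimage ch cg hK' gK sW.
    (* With no point of [X] adherent to [Y], every proper filter on [Y] clusters in [Y], so the
       empty family separates vacuously. *)
    exists setT => //; split; first exact: openT.
    exists set0; split=> // F FF F0.
    have [x clx] := cluster_fmap_remainder cK jopen jr FF F0.
    exfalso; apply: nclx; exists x; apply: cluster_closure clx _.
    by apply: (@filterE _ F _ (j @^-1` range j)) => a; exists a.
  have [|W [cW WO WY]] := feathering_lindelof hK cK fU _ OY.
    by move=> V [].
  have -> : [set: set_type (~` range e)] =
      \bigcup_(V in [set j @^-1` V | V in W]) V.
    apply/seteqP; split=> // y _.
    have [|V WV Vy] := WY (j y); first by rewrite -jr; exists y.
    by exists (j @^-1` V) => //; exists V.
  apply: countably_separated_bigcup; first exact: countable_image.
  by move=> _ [V /WO[_ sV] <-].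
split; first exact: tychonoff_set_type.
have [e' ce'] := @closure_compactification K (~` range e) hK cK.
exists (set_type (closure (~` range e))), e'; split=> //.
exact: countably_separated_source.
Qed.
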